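(* Let $L>0$, $\mu\in(0,L)$, let $f:\mathbb{R}^d\to\mathbb{R}$ belong to $\mathcal{F}_{\mu,L}$, put $f_*:=\inf_x f(x)$, let $N\ge 1$ be an integer, and let $x_{i+1}=x_i-\gamma\nabla f(x_i)$, $i=0,\dots,N-1$, be $N$ iterations of gradient descent started from $x_0\in\mathbb{R}^d$ with constant stepsize $\gamma$ satisfying $\gamma L\in(0,2)$. Then $$\frac{1}{2L}\|\nabla f(x_N)\|^2\le \frac{f(x_0)-f_*}{1+\gamma L\,\min\Big\{\frac{-1+(1-\gamma\mu)^{-2N}}{\gamma\mu},\ \frac{-1+(1-\gamma L)^{-2N}}{\gamma L}\Big\}}.$$
   Context: For $L\in(0,\infty)$ and $\mu\in(-\infty,L)$, $\mathcal{F}_{\mu,L}$ is the class of functions $f:\mathbb{R}^d\to\mathbb{R}$ such that both $\frac{L}{2}\|\cdot\|^2-f$ and $f-\frac{\mu}{2}\|\cdot\|^2$ are convex, where $\|\cdot\|$ is the Euclidean norm (such functions are differentiable). When $1-\gamma L=0$ (resp. $1-\gamma\mu=0$), the quantity $(1-\gamma L)^{-2N}$ (resp. $(1-\gamma\mu)^{-2N}$) is read as $+\infty$, so the minimum equals its other argument. *)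

(* Defs.v *)
From HB Require Import structures.
From mathcomp Require Import all_boot all_order all_algebra.
From mathcomp Require Import all_classical all_reals all_analysis.

Set Implicit Arguments.
Unset Strict Implicit.
Unset Printing Implicit Defensive.

Import Order.TTheory GRing.Theory Num.Theory.
Import numFieldNormedType.Exports.

Local Open Scope classical_set_scope.
Local Open Scope ring_scope.

(* The canonical norm `|x| on 'rV[R]_d is the sup norm, hence this definition. *)
Definition enorm (R : realType) (d : nat) (x : 'rV[R]_d) : R :=
  Num.sqrt (\sum_(i < d) x ord0 i ^+ 2).

Definition gradient (R : realType) (d : nat) (f : 'rV[R]_d -> R)
    (x : 'rV[R]_d) : 'rV[R]_d :=
  \row_(i < d) 'D_(delta_mx ord0 i) f x.

Definition curvature_class (R : realType) (d : nat) (mu L : R) :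
    set ('rV[R]_d -> R) :=
  [set f | convex_function setT
             (fun x : 'rV[R]_d => L / 2 * enorm x ^+ 2 - f x)
         /\ convex_function setT
             (fun x : 'rV[R]_d => f x - mu / 2 * enorm x ^+ 2)].

(* (-1 + (1 - gamma * m)^(-2N)) / (gamma * m) in \bar R: since 0^-1 = +oo there,
   the value is +oo when 1 - gamma * m = 0 and gamma * m > 0. *)
Definition rate_term (R : realType) (gamma m : R) (N : nat) : \bar R :=
  ((- 1 + ((1 - gamma * m)%:E ^+ (2 * N))^-1) / (gamma * m)%:E)%E.

(* Main.v *)
Require Import Defs.
From HB Require Import structures.
From mathcomp Require Import all_boot all_order all_algebra.
From mathcomp Require Import all_classical all_reals all_analysis.
From mathcomp Require Import ring lra.

Import Order.TTheory GRing.Theory Num.Theory.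
Import numFieldNormedType.Exports.

Local Open Scope classical_set_scope.
Local Open Scope ring_scope.

(** Put F = gamma f, G = gamma grad f, a = 1 - gamma mu and b = 1 - gamma L, so
    that the iteration reads x_(i+1) = x_i - G(x_i) and the curvature of F lies
    between 1 - a and 1 - b.  With S_n(z) = z + z^2 + ... + z^n, the two numbers
    in the minimum are S_2N(1/a) and S_2N(1/b).

    A gradient step of length 1/L from x_N shows that f_* is at most
    f(x_N) - |grad f(x_N)|^2 / (2 L).  It therefore suffices to prove
    E |G(x_N)|^2 <= 2 (F(x_0) - F(x_N)), where E is the smaller of the two
    numbers; the infimum does not occur any more.

    _Reduction to a critical pair._  If S_2N(1/a) is the smaller number, raise
    L; otherwise lower mu, possibly below zero.  Both changes enlarge the class of
    functions, and by the intermediate value theorem they can be made so that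
    S_2N(1/a) = S_2N(1/b) with b < 0 < a.  For such a pair the quadratics of
    curvature mu and L are both extremal
    ([descent_low_curvature], [descent_high_curvature]).

    _The critical case_ ([critical_descent]).  The interpolation inequalities
    between two points, taken in both directions, bound the error of the
    trapezoidal rule for the difference of values
    ([quad_sandwich_trapezoid]).  The claim is a nonnegative combination of
    these bounds for the pairs (x_i, x_(i+1)) and (x_i, x_(i+2)), without any
    remaining square.  Tightness at both quadratics turns the conditions on the
    weights into a linear recursion with characteristic roots a^(-2) and b^(-2).
    Its solution gives the pair (x_(k-1), x_(k+1)) the weight
      q_k = (S_2k(1/a) - S_2k(1/b)) / 2,
    which vanishes at k = 0 and, at criticality, at k = N.  Its increments
    change sign at most once, from positive to negative, whence q_k >= 0
    ([gap_ge0]); the weights of consecutive pairs have the right sign by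
    [weights_bound].  The combination is carried out one step at a time:
    [multiplier_identity] is the polynomial identity behind each step. *)

Set Implicit Arguments.
Unset Strict Implicit.

(** * Inner product of row vectors *)

Section Dot.
Variables (R : realType) (d : nat).
Implicit Types u v w : 'rV[R]_d.

Definition dot u v : R := \sum_(i < d) u ord0 i * v ord0 i.

Lemma dotC u v : dot u v = dot v u.
Proof. by apply: eq_bigr => i _; rewrite mulrC. Qed.

Lemma dotDl u v w : dot (u + v) w = dot u w + dot v w.
Proof. by rewrite -big_split; apply: eq_bigr => i _; rewrite mxE mulrDl. Qed.

Lemma dotZl k u v : dot (k *: u) v = k * dot u v.
Proof. by rewrite mulr_sumr; apply: eq_bigr => i _; rewrite mxE mulrA. Qed.

Lemma dotDr u v w : dot w (u + v) = dot w u + dot w v.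
Proof. by rewrite dotC dotDl !(dotC w). Qed.

Lemma dotZr k u v : dot v (k *: u) = k * dot v u.
Proof. by rewrite dotC dotZl dotC. Qed.

Lemma dotNl u v : dot (- u) v = - dot u v.
Proof. by rewrite -scaleN1r dotZl mulN1r. Qed.

Lemma dotNr u v : dot v (- u) = - dot v u.
Proof. by rewrite dotC dotNl dotC. Qed.

Definition dotE := (dotDl, dotDr, dotZl, dotZr, dotNl, dotNr).

Lemma enorm_sqr u : enorm u ^+ 2 = dot u u.
Proof.
rewrite /enorm sqr_sqrtr; last by apply: sumr_ge0 => i _; exact: sqr_ge0.
by apply: eq_bigr => i _; rewrite expr2.
Qed.

Lemma dot_ge0 u : 0 <= dot u u.
Proof. by rewrite -enorm_sqr sqr_ge0. Qed.

End Dot.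

(** * Quadratic bounds from the two convexity conditions *)

Section Sandwich.
Variables (R : realType) (d : nat).
Implicit Types (x u v : 'rV[R]_d) (f phi : 'rV[R]_d -> R).

Lemma convex_functionE {phi} (t : R) x y :
  convex_function setT (phi : convex_lmodType 'rV[R]_d -> R^o) -> 0 <= t <= 1 ->
  phi (t *: x + (1 - t) *: y) <= t * phi x + (1 - t) * phi y.
Proof.
move=> cvx /andP[t0 t1].
by have := cvx (Itv01 t0 t1) x y (in_setT _) (in_setT _).
Qed.

(** Along a line, every backward slope of a convex function at [x] is at most
    every forward slope; the supremum of the backward slopes separates them. *)
Lemma convex_subgradient {phi} x v :
  convex_function setT (phi : convex_lmodType 'rV[R]_d -> R^o) ->
  exists l, forall t, phi x + t * l <= phi (x + t *: v).
Proof.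
move=> cvx.
pose S := [set r | exists2 t : R, 0 < t & r = (phi x - phi (x - t *: v)) / t].
have slopes s t : 0 < s -> 0 < t ->
    (phi x - phi (x - t *: v)) / t <= (phi (x + s *: v) - phi x) / s.
  move=> s0 t0; rewrite ler_pdivrMr// mulrAC ler_pdivlMr//.
  have st0 : 0 < s + t by rewrite addr_gt0.
  have := @convex_functionE phi (t / (s + t)) (x + s *: v) (x - t *: v) cvx.
  have -> : t / (s + t) *: (x + s *: v) + (1 - t / (s + t)) *: (x - t *: v) = x.
    apply/matrixP => i j; rewrite !mxE; field; lra.
  have -> : 0 <= t / (s + t) <= 1.
    by rewrite ltW ?divr_gt0//= ler_pdivrMr// mul1r lerDr ltW.
  move=> /(_ isT) /(ler_wpM2l (ltW st0)).
  have -> : (s + t) * (t / (s + t) * phi (x + s *: v)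
      + (1 - t / (s + t)) * phi (x - t *: v))
      = t * phi (x + s *: v) + s * phi (x - t *: v) by field; lra.
  lra.
have S0 : S !=set0 by exists ((phi x - phi (x - 1 *: v)) / 1); exists 1.
have ubS s : 0 < s -> ubound S ((phi (x + s *: v) - phi x) / s).
  by move=> s0 r [t t0 ->]; exact: slopes.
have supS : has_sup S.
  by split=> //; exists ((phi (x + 1 *: v) - phi x) / 1); exact: ubS.
exists (sup S) => t; have [t0|t0|->] := ltrgtP t 0.
- have := sup_upper_bound supS.
  move=> /(_ ((phi x - phi (x - (- t) *: v)) / (- t))).
  have nt0 : 0 < - t by rewrite oppr_gt0.
  move=> /(_ (ex_intro2 _ _ (- t) nt0 erefl)).
  rewrite ler_pdivrMr// scaleNr opprK; lra.
- have := ge_sup S0 (ubS _ t0); rewrite ler_pdivlMr//; lra.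
- by rewrite mul0r addr0 scale0r addr0.
Qed.

Lemma quadratic_slope_eq0 (c C : R) : (forall t, t * c <= C * t ^+ 2) -> c = 0.
Proof.
move=> h; set K := `|C| + 1.
have K0 : 0 < K by rewrite ltr_pwDr.
have CK : C <= K by rewrite (le_trans (ler_norm C))// lerDl.
have := h (c / (2 * K)).
have -> : c / (2 * K) * c = 2 * (K * (c / (2 * K)) ^+ 2) by field; lra.
have := ler_wpM2r (sqr_ge0 (c / (2 * K))) CK => h1 h2.
have : K * (c / (2 * K)) ^+ 2 <= 0 by lra.
rewrite pmulr_rle0// real_exprn_even_le0 ?num_real//= mulf_eq0 invr_eq0.
have KK : 0 < 2 * K by rewrite mulr_gt0.
by rewrite (gt_eqF KK) orbF => /eqP.
Qed.

(** The slopes [l] and [l'] of the two convex functions in the definition of the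
    class must add up to the slope of the quadratic that is the sum of the two
    functions, because the sum of the tangents stays below it on both sides of
    [x].  One number then serves for
    the lower and for the upper bound, without any limit being taken. *)
Lemma curvature_class_line {m M f} x v : curvature_class m M f ->
  exists l, forall t,
    f x + t * l + m / 2 * t ^+ 2 * dot v v <= f (x + t *: v) /\
    f (x + t *: v) <= f x + t * l + M / 2 * t ^+ 2 * dot v v.
Proof.
move=> [cvxM cvxm].
have [l hl] := convex_subgradient x v cvxm.
have [l' hl'] := convex_subgradient x v cvxM.
rewrite /= in hl hl'.
have ll' : l + l' = (M - m) * dot x v.
  apply/eqP; rewrite -subr_eq0; apply/eqP.
  apply: (@quadratic_slope_eq0 _ ((M - m) / 2 * dot v v)) => t.
  have := hl t; have := hl' t.
  rewrite !enorm_sqr !dotE (dotC v x); lra.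
exists (l + m * dot x v) => t; split.
  by have := hl t; rewrite !enorm_sqr !dotE (dotC v x); lra.
have := hl' t; rewrite !enorm_sqr !dotE (dotC v x).
have -> : l' = (M - m) * dot x v - l by lra.
lra.
Qed.


Lemma derive_of_quadratic_bound f x v l C :
  (forall t, `|f (x + t *: v) - f x - t * l| <= C * t ^+ 2) ->
  'D_v (f : 'rV[R]_d -> R^o) x = l.
Proof.
move=> h.
have C0 : 0 <= C by have := h 1; rewrite expr1n mulr1; apply: le_trans.
apply: cvg_lim => //; apply/cvgrPdist_le => e e0; near=> t.
have t0 : t != 0 by near: t; exact: nbhs_dnbhs_neq.
have te : `|t| <= e / (C + 1).
  by near: t; apply: dnbhs0_le; rewrite divr_gt0// ltr_wpDl.
have nt0 : 0 < `|t| by rewrite normr_gt0.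
rewrite /= [t *: v + x]addrC distrC -(ler_pM2r nt0) -normrM.
have -> : (t^-1 *: (f (x + t *: v) - f x) - l) * t
        = f (x + t *: v) - f x - t * l.
  by rewrite /GRing.scale/=; field.
apply: le_trans (h t) _; rewrite -real_normK ?num_real// expr2 mulrA.
rewrite ler_pM2r//; apply: le_trans (_ : (C + 1) * `|t| <= _).
  by rewrite ler_wpM2r// lerDl.
by rewrite mulrC -ler_pdivlMr// ltr_wpDl.
Unshelve. all: end_near.
Qed.

(** The first-order form of the curvature condition, with [g] in the role of the
    gradient. *)
Definition quad_sandwich (m M : R) f (g : 'rV[R]_d -> 'rV[R]_d) :=
  forall x v, f x + dot (g x) v + m / 2 * dot v v <= f (x + v)
     /\ f (x + v) <= f x + dot (g x) v + M / 2 * dot v v.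

(** The slopes of the preceding lemma are additive in the direction: convexity
    at the midpoint of [x + 2 t u] and [x + 2 t v] bounds the defect times [t]
    by a multiple of [t ^ 2], for [t] of either sign.  Hence they are given by
    the vector of their values on the basis, and these values are the partial
    derivatives. *)
Lemma curvature_class_sandwich {m M f} : m <= M -> curvature_class m M f ->
  quad_sandwich m M f (gradient f).
Proof.
move=> mM fc.
pose l x v : R := projT1 (cid (curvature_class_line x v fc)).
have lP x v : forall t,
    f x + t * l x v + m / 2 * t ^+ 2 * dot v v <= f (x + t *: v) /\
    f (x + t *: v) <= f x + t * l x v + M / 2 * t ^+ 2 * dot v v.
  by rewrite /l; case: cid.
have lD x u v : l x (u + v) = l x u + l x v.
  apply/eqP; rewrite -subr_eq0; apply/eqP.
  apply: (@quadratic_slope_eq0 _ ((M - m) * (dot u u + dot v v))) => t.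
  have half : (0 <= 2^-1 :> R) && (2^-1 <= 1 :> R) by apply/andP; split; lra.
  have := convex_functionE (x + (2 * t) *: u) (x + (2 * t) *: v) fc.2 half.
  have -> : 2^-1 *: (x + (2 * t) *: u) + (1 - 2^-1) *: (x + (2 * t) *: v)
          = x + t *: (u + v).
    by apply/matrixP => i j; rewrite !mxE; field.
  have [+ _] := lP x (u + v) t.
  have [_ +] := lP x u (2 * t).
  have [_ +] := lP x v (2 * t).
  rewrite !enorm_sqr !dotE (dotC v x) (dotC u x) (dotC v u) !exprMn.
  lra.
have lZ x k v : l x (k *: v) = k * l x v.
  apply/eqP; rewrite -subr_eq0; apply/eqP.
  apply: (@quadratic_slope_eq0 _ ((M - m) / 2 * k ^+ 2 * dot v v)) => t.
  have [+ _] := lP x (k *: v) t.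
  have [_ +] := lP x v (t * k).
  by rewrite !dotE scalerA exprMn; lra.
have l0 x : l x 0 = 0 by rewrite -(scale0r (0 : 'rV[R]_d)) lZ mul0r.
have lE x v : l x v = dot (gradient f x) v.
  have lsum (F : 'I_d -> 'rV[R]_d) : l x (\sum_i F i) = \sum_i l x (F i).
    exact: (big_morph (l x) (lD x) (l0 x)).
  rewrite [in LHS](row_sum_delta v) lsum; apply: eq_bigr => i _.
  rewrite lZ mulrC mxE; congr (_ * _); apply/esym.
  pose q := dot (delta_mx ord0 i : 'rV[R]_d) (delta_mx ord0 i).
  apply: (@derive_of_quadratic_bound _ _ _ _ ((`|m| + `|M|) / 2 * q)) => t.
  have [] := lP x (delta_mx ord0 i) t; rewrite -/q.
  have q0 : 0 <= q := dot_ge0 _.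
  have qt : 0 <= q * t ^+ 2 by rewrite mulr_ge0 ?sqr_ge0.
  have := ler_wpM2r qt (ler_norm M); have := ler_wpM2r qt (ler_norm (- m)).
  have := mulr_ge0 (normr_ge0 M) qt; have := mulr_ge0 (normr_ge0 m) qt.
  rewrite normrN ler_norml => *; apply/andP; split; lra.
move=> x v; have := lP x v 1.
by rewrite scale1r mul1r expr1n !mulr1 lE.
Qed.

End Sandwich.

(** * Interpolation inequalities *)

Section Interpolation.
Variables (R : realType) (d : nat).
Implicit Types (x u v : 'rV[R]_d).
Implicit Types (f : 'rV[R]_d -> R) (g : 'rV[R]_d -> 'rV[R]_d).

Lemma quad_sandwich_widen m M m' M' f g : m' <= m -> M <= M' ->
  quad_sandwich m M f g -> quad_sandwich m' M' f g.
Proof.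
move=> mm MM h x v; have [h1 h2] := h x v; have v0 := dot_ge0 v.
have := ler_wpM2r v0 mm; have := ler_wpM2r v0 MM; split; lra.
Qed.

Lemma quad_sandwich_scale c m M f g : 0 <= c -> quad_sandwich m M f g ->
  quad_sandwich (c * m) (c * M) (fun x => c * f x) (fun x => c *: g x).
Proof.
move=> c0 h x v; have [h1 h2] := h x v; rewrite dotZl.
have := ler_wpM2l c0 h1; have := ler_wpM2l c0 h2; split; lra.
Qed.

(** The lower bound from [y] and the upper bound from [x] are compared at the
    point [x - (M - m)^-1 w], where [w] is the difference of the gradients of
    [f - m/2 |.|^2]; it minimizes the upper bound minus the lower one. *)
Lemma quad_sandwich_interpolation m M f g x y :
  m < M -> quad_sandwich m M f g ->
  dot (g x - g y - m *: (x - y)) (g x - g y - m *: (x - y)) <=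
  2 * (M - m) * (f x - f y - dot (g y) (x - y) - m / 2 * dot (x - y) (x - y)).
Proof.
move=> mM h; have D0 : 0 < M - m by rewrite subr_gt0.
have [e eE] : exists e, e = x - y by exists (x - y).
have [w wE] : exists w, w = g x - g y - m *: e by eexists.
rewrite -!eE -wE.
have kD : (M - m) * (M - m)^-1 = 1 by rewrite divff// gt_eqF.
move: ((M - m)^-1) kD => k kD.
have [+ _] := h y (e - k *: w); have [_ +] := h x (- (k *: w)).
have -> : y + (e - k *: w) = x - k *: w by rewrite eE addrA (addrC y) subrK.
have ww : dot w w = dot (g x) w - dot (g y) w - m * dot e w.
  by rewrite {1}wE !dotE; ring.
rewrite !dotE (dotC w e) => h1 h2; have h3 := le_trans h2 h1.
have kw := congr1 (fun r => k * r) ww.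
have kkw := congr1 (fun r => r * (k * dot w w)) kD.
rewrite /= mul1r in kw kkw.
have T : k * dot w w / 2 <= f x - f y - dot (g y) e - m / 2 * dot e e by lra.
have := ler_wpM2l (ltW D0) T; rewrite mulrA mulrA kD mul1r; lra.
Qed.

(** The average of the two interpolation inequalities between [x] and [y] is
    cocoercivity of the gradient, in which no value of [f] occurs; their
    difference is the trapezoidal rule.  Both together are this estimate. *)
Lemma quad_sandwich_trapezoid m M f g x y : m < M -> quad_sandwich m M f g ->
  (M - m) * `|2 * (f x - f y) - dot (g x + g y) (x - y)| <=
  dot (g x - g y - m *: (x - y)) (M *: (x - y) - (g x - g y)).
Proof.
move=> mM h; have D0 : 0 < M - m by rewrite subr_gt0.
have := quad_sandwich_interpolation x y mM h.
have := quad_sandwich_interpolation y x mM h.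
have -> : y - x = - (x - y) by rewrite opprB.
move: (x - y) => e h1 h2; rewrite -{1}(gtr0_norm D0) -normrM ler_norml.
move: h1 h2; rewrite !dotE !(dotC e) !(dotC (g y) (g x)) => h1 h2.
by apply/andP; split; lra.
Qed.

End Interpolation.

(** * Power sums and the weights of the combination *)

Section PowerSum.
Variable R : realFieldType.
Implicit Types x y z : R.

Definition pow_sum n z : R := \sum_(j < n) z ^+ j.+1.

Lemma pow_sum0 z : pow_sum 0 z = 0. Proof. by rewrite /pow_sum big_ord0. Qed.

Lemma pow_sumS n z : pow_sum n.+1 z = pow_sum n z + z ^+ n.+1.
Proof. by rewrite /pow_sum big_ord_recr. Qed.

Lemma pow_sumSS n z : pow_sum n.+2 z = pow_sum n z + z ^+ n.+1 + z ^+ n.+2.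
Proof. by rewrite !pow_sumS. Qed.

Lemma pow_sumE n z : z != 0 -> (1 - z^-1) * pow_sum n z = z ^+ n - 1.
Proof.
move=> z0; elim: n => [|n IH]; first by rewrite pow_sum0 mulr0 subrr.
by rewrite pow_sumS mulrDr IH exprS; field.
Qed.

Lemma evenexp_opp k y : (- y) ^+ k.*2 = y ^+ k.*2.
Proof. by rewrite exprNn -signr_odd odd_double mul1r. Qed.

Lemma oddexp_opp k y : (- y) ^+ k.*2.+1 = - y ^+ k.*2.+1.
Proof. by rewrite exprS evenexp_opp mulNr -exprS. Qed.

Lemma pow_sum_oppS k y :
  pow_sum k.+1.*2 (- y) = pow_sum k.*2 (- y) + (y ^+ k.+1.*2 - y ^+ k.*2.+1).
Proof. by rewrite doubleS pow_sumSS -doubleS evenexp_opp oddexp_opp; ring. Qed.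

Lemma pow_sum_opp_ge0 k y : 1 <= y -> 0 <= pow_sum k.*2 (- y).
Proof.
move=> y1; elim: k => [|k IH]; first by rewrite pow_sum0.
by rewrite pow_sum_oppS addr_ge0// subr_ge0 doubleS ler_weXn2l.
Qed.

Lemma pow_sum_opp_ge k y : 1 <= y -> y - 1 <= pow_sum k.+1.*2 (- y).
Proof.
move=> y1; rewrite pow_sum_oppS ler_wpDl ?pow_sum_opp_ge0// doubleS exprS.
have : 1 <= y ^+ k.*2.+1 by rewrite exprn_ege1.
nra.
Qed.

Lemma pow_sum_ge0 n x : 0 <= x -> 0 <= pow_sum n x.
Proof. by move=> x0; apply: sumr_ge0 => j _; rewrite exprn_ge0. Qed.

Lemma pow_sum_ge n x : 0 <= x -> x <= pow_sum n.+1 x.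
Proof.
move=> x0; rewrite /pow_sum big_ord_recl expr1 lerDl.
by apply: sumr_ge0 => j _; rewrite exprn_ge0.
Qed.

End PowerSum.

Section Gap.
Variable R : realFieldType.
Implicit Types x y : R.

(** Twice the weight of the pair (x_(k-1), x_(k+1)), with [x = 1/a] and
    [y = - 1/b].  Criticality is the equation [gap x y N = 0]. *)
Definition gap x y k : R := pow_sum k.*2 x - pow_sum k.*2 (- y).

Lemma gapS x y k : gap x y k.+1 =
  gap x y k + (x ^+ k.*2.+1 * (1 + x) - y ^+ k.*2.+1 * (y - 1)).
Proof.
rewrite /gap pow_sum_oppS doubleS pow_sumSS -doubleS.
by rewrite doubleS !exprS; ring.
Qed.

Lemma gap0 x y : gap x y 0 = 0. Proof. by rewrite /gap !pow_sum0 subrr. Qed.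

(** If [y < x], every increment of [gap] is positive. *)
Lemma gap_eq0_le x y N :
  0 < x -> 1 < y -> (0 < N)%N -> gap x y N = 0 -> x <= y.
Proof.
move=> x0 y1 N0 gN; have y0 : 0 < y by lra.
rewrite leNgt; apply/negP => yx.
have inc k : gap x y k < gap x y k.+1.
  rewrite gapS ltrDl subr_gt0.
  have yk : 0 < y ^+ k.*2.+1 by rewrite exprn_gt0// (lt_trans _ y1).
  have : y ^+ k.*2.+1 <= x ^+ k.*2.+1 by rewrite lerXn2r ?nnegrE ?ltW//.
  have yy : 0 <= y - 1 by rewrite subr_ge0 ltW.
  move=> YX; apply: le_lt_trans (ler_wpM2r yy YX) _.
  by rewrite ltr_pM2l ?exprn_gt0//; lra.
have pos k : 0 < gap x y k.+1.
  elim: k => [|k IH]; first by have := inc 0; rewrite gap0.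
  exact: lt_trans IH (inc _).
by case: N N0 gN => // N _ gN; have := pos N; rewrite gN ltxx.
Qed.

(** The two terms of the [k]-th increment grow by the factors [x ^ 2] and
    [y ^ 2], so once an increment is negative all later ones are.  As [gap]
    starts from zero, a negative value needs a negative increment before it. *)
Lemma gap_neg_decr x y k :
  0 < x -> 1 < y -> x <= y -> gap x y k < 0 -> gap x y k.+1 < gap x y k.
Proof.
move=> x0 y1 xy; have y0 : 0 < y by lra.
have dec j : x ^+ j.*2.+1 * (1 + x) < y ^+ j.*2.+1 * (y - 1) ->
    x ^+ j.+1.*2.+1 * (1 + x) < y ^+ j.+1.*2.+1 * (y - 1).
  move=> h; rewrite doubleS exprS (exprS _ j.*2.+1) (exprS y) (exprS y j.*2.+1).
  have xj : 0 < x ^+ j.*2.+1 by rewrite exprn_gt0.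
  have xx : x * x <= y * y by nra.
  have h1 : x * x * (x ^+ j.*2.+1 * (1 + x)) < x * x * (y ^+ j.*2.+1 * (y - 1)).
    by rewrite ltr_pM2l// mulr_gt0.
  have yj : 0 <= y ^+ j.*2.+1 * (y - 1).
    by rewrite mulr_ge0 ?exprn_ge0// ?subr_ge0; lra.
  have := ler_wpM2r yj xx.
  lra.
suff H : gap x y k < 0 -> x ^+ k.*2.+1 * (1 + x) < y ^+ k.*2.+1 * (y - 1).
  by move=> /H; rewrite gapS; lra.
elim: k => [|k IH]; first by rewrite gap0 ltxx.
have [gk|gk] := ltP (gap x y k) 0; first by move=> _; apply: dec; exact: IH.
by rewrite gapS => gk1; apply: dec; lra.
Qed.

Lemma gap_ge0 x y N k : 0 < x -> 1 < y -> x <= y ->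
  gap x y N = 0 -> (k <= N)%N -> 0 <= gap x y k.
Proof.
move=> x0 y1 xy gN kN; rewrite leNgt; apply/negP => gk.
have : gap x y (k + (N - k)) < 0.
  elim: (N - k)%N => [|n IH]; first by rewrite addn0.
  by rewrite addnS (lt_trans (gap_neg_decr x0 y1 xy IH)).
by rewrite subnKC// gN ltxx.
Qed.

(** For [x <= 1] the nonnegative power sum of [- y] is dropped, and
    [(y - x) x ^ j] is at most [(y ^ (j+1) - y ^ j) + (x ^ j - x ^ (j+1))],
    which telescopes.  For [1 < x] the difference of the two sides increases
    with [k]. *)
Lemma gap_bound x y k : 0 < x -> 1 < y -> x <= y ->
  (y - x) * gap x y k <=
  x + y + x * (x ^+ k.*2.+1 + y ^+ k.*2.+1)
  + y * (y ^+ k.*2.+2 - x ^+ k.*2.+2).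
Proof.
move=> x0 y1 xy; have y0 : 0 < y by lra.
have [x1|x1] := leP x 1.
  have tele n : (y - x) * pow_sum n x <= y ^+ n.+1 - y + (x - x ^+ n.+1).
    elim: n => [|n IH]; first by rewrite pow_sum0 mulr0 !expr1; lra.
    rewrite pow_sumS mulrDr (exprS y n.+1) (exprS x n.+1).
    have : x ^+ n.+1 <= y ^+ n.+1 by rewrite lerXn2r ?nnegrE// ltW.
    nra.
  have gle : (y - x) * gap x y k <= (y - x) * pow_sum k.*2 x.
    by rewrite ler_wpM2l ?subr_ge0// /gap lerBlDr lerDl pow_sum_opp_ge0 ?ltW.
  apply: (le_trans gle); apply: (le_trans (tele _)).
  have xk : 0 <= x ^+ k.*2.+1 <= 1 by rewrite exprn_ge0 ?exprn_ile1// ltW.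
  have yk : 1 <= y ^+ k.*2.+1 by rewrite exprn_ege1 ?ltW.
  move: xk yk; rewrite !(exprS _ k.*2.+1).
  set X := x ^+ _; set Y := y ^+ _ => /andP[X0 X1] Y1.
  have Y0 : 0 <= Y by lra.
  have yy : 1 <= y * y by nra.
  have h1 : Y <= y * (y * Y) by rewrite mulrA ler_peMl.
  have xX : x * X <= 1 by rewrite mulr_ile1// ltW.
  have h2 : y * (x * X) <= y by rewrite ler_piMr// ltW.
  have h3 : 0 <= x * X by rewrite mulr_ge0// ltW.
  have h4 : 0 <= x * Y by rewrite mulr_ge0// ltW.
  lra.
elim: k => [|k IH].
  have [x0' y0'] := (ltW x0, ltW y0).
  have yx2 : 0 <= y ^+ 0.*2.+2 - x ^+ 0.*2.+2 by rewrite subr_ge0 lerXn2r.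
  by rewrite gap0 mulr0 !addr_ge0// mulr_ge0// addr_ge0.
rewrite gapS mulrDr; apply: le_trans (lerD IH (lexx _)) _.
rewrite !doubleS !(exprS _ k.*2.+3) !(exprS _ k.*2.+2) !(exprS _ k.*2.+1).
have : x ^+ k.*2.+1 <= y ^+ k.*2.+1 by rewrite lerXn2r ?nnegrE// ltW.
have : 0 <= x ^+ k.*2.+1 by rewrite exprn_ge0 ?ltW.
set X := x ^+ _; set Y := y ^+ _ => X0 XY.
rewrite -subr_ge0.
have -> : x + y + x * (x * (x * X) + y * (y * Y))
    + y * (y * (y * (y * Y)) - x * (x * (x * X)))
  - (x + y + x * (X + Y) + y * (y * Y - x * X)
     + (y - x) * (X * (1 + x) - Y * (y - 1)))
  = X * ((1 + x) * (x ^+ 2 - y * (1 - x + x ^+ 2)))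
    + Y * (y * (y - 1) * (x + y ^+ 2 + y + 1)).
  by ring.
have Yc : 0 <= y * (y - 1) * (x + y ^+ 2 + y + 1).
  by rewrite ?(mulr_ge0, subr_ge0, sqr_ge0, addr_ge0)// ltW.
have := ler_wpM2r Yc XY => h.
suff : 0 <= X * ((1 + x) * (x ^+ 2 - y * (1 - x + x ^+ 2))
   + y * (y - 1) * (x + y ^+ 2 + y + 1)) by lra.
rewrite mulr_ge0//.
have u0 : 0 <= x - 1 by rewrite subr_ge0 ltW.
have e0 : 0 <= y - x by rewrite subr_ge0.
(* In powers of [x - 1] and [y - x] all coefficients are nonnegative. *)
have -> : (1 + x) * (x ^+ 2 - y * (1 - x + x ^+ 2))
    + y * (y - 1) * (x + y ^+ 2 + y + 1)
  = (y - x) * (2 + 7 * (y - x) + 4 * (y - x) ^+ 2 + (y - x) ^+ 3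
      + (x - 1) * (12 + 13 * (y - x) + 4 * (y - x) ^+ 2)
      + (x - 1) ^+ 2 * (11 + 6 * (y - x)) + 3 * (x - 1) ^+ 3)
    + (x - 1) * (4 + 6 * (x - 1) + 2 * (x - 1) ^+ 2) by ring.
move: (x - 1) (y - x) u0 e0 => u e u0 e0.
by rewrite ?(mulr_ge0, exprn_ge0, addr_ge0).
Qed.

End Gap.

Section Weights.
Variable R : realFieldType.

(** One step of the combination.  The [n]s stand for the inner products of three
    consecutive gradients, [t0] and [t1] for the two trapezoidal errors, [X] and
    [Z] for [a ^ (- 2 k)] and [b ^ (- 2 k)], [q] and [q'] for consecutive
    weights at distance two, and [m] for the weight of the last two points.
    On the left is the growth of the potential used in [critical_descent]; on
    the right are the trapezoidal bounds [C1] at distance one and [C2] at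
    distance two.  The two sides differ by a multiple of the hypothesis, which
    is the closed form of [q], without division by [1 - a] since [a = 1] may
    occur. *)
Lemma multiplier_identity (a b q X Z n00 n01 n02 n11 n12 n22 t0 t1 : R) :
  a != 0 -> b != 0 ->
  2 * q * (1 - a) * (1 - b) = (1 - b) * (X - 1) - (1 - a) * (Z - 1) ->
  let s := a + b in let D := a - b in let p := a * b in
  let f1 := X / a - Z / b in let f2 := X / a ^+ 2 - Z / b ^+ 2 in
  let q' := q + (f1 + f2) / 2 in let m := (f1 - f2) / 2 in
  let C0 := s * n01 - n11 - p * n00 in
  let C1 := s * n12 - n22 - p * n11 in
  let C2 := - p * n00 - (1 - a) * (1 - b) * n11 - n22
    + (s - 2 * p) * n01 + s * n02 + (s - 2) * n12 in
  D * (D * t1 + D * (n11 + n12) + q * (s * t0 + C0 - 2 * p * n01)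
     + (2 * q - (X - Z)) * n11 - q' * (s * t1 + C1 - 2 * p * n12)
     - (2 * q + f1) * n22)
  = D * m * C1 + (D - s * (q' + q)) * (D * t1)
    + q * (D * C2 + s * (D * (t0 + t1) - D * (n02 - n11))).
Proof.
move=> a0 b0 rel s D p f1 f2 q' m C0 C1 C2.
transitivity (D * m * C1 + (D - s * (q' + q)) * (D * t1)
    + q * (D * C2 + s * (D * (t0 + t1) - D * (n02 - n11)))
   + D * (n11 + n12) * (2 * q * (1 - a) * (1 - b) - 
     ((1 - b) * (X - 1) - (1 - a) * (Z - 1)))).
  by rewrite /C0 /C1 /C2 /q' /m /f1 /f2 /p /D /s; field; rewrite ?a0 ?b0.
by rewrite rel subrr mulr0 addr0.
Qed.

Lemma gap_closed (x y : R) k : 0 < x -> 0 < y ->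
  gap x y k * (1 - x^-1) * (1 + y^-1)
  = (1 + y^-1) * (x ^+ k.*2 - 1) - (1 - x^-1) * (y ^+ k.*2 - 1).
Proof.
move=> x0 y0; have ny0 : - y != 0 by rewrite oppr_eq0 gt_eqF.
have := pow_sumE k.*2 (lt0r_neq0 x0); have := pow_sumE k.*2 ny0.
rewrite evenexp_opp invrN opprK /gap => <- <-; ring.
Qed.

(** The weight of a consecutive pair must dominate the net flow of the function
    value through it, in absolute value, for both one-sided multipliers to be
    nonnegative.  It is at least one, which settles one sign; the other is
    [gap_bound]. *)
Lemma weights_bound (x y : R) k : 0 < x -> 1 < y -> x <= y ->
  0 <= gap x y k -> 0 <= gap x y k.+1 ->
  `|x^-1 + y^-1 - (x^-1 - y^-1) * (gap x y k.+1 / 2 + gap x y k / 2)| <=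
  (x^-1 + y^-1) *
    ((x ^+ k.*2.+1 + y ^+ k.*2.+1 - (x ^+ k.*2.+2 - y ^+ k.*2.+2)) / 2).
Proof.
move=> x0 y1 xy g0 g1; set m := (x ^+ _ + _ - _) / 2; have y0 : 0 < y by lra.
have gb := gap_bound k x0 y1 xy.
have m1 : 1 <= m.
  rewrite /m (exprS x k.*2.+1) (exprS y k.*2.+1).
  have Y1 : 1 <= y ^+ k.*2.+1 by rewrite exprn_ege1 ?ltW.
  have X0 : 0 <= x ^+ k.*2.+1 by rewrite exprn_ge0 ?ltW.
  have YY : y ^+ k.*2.+1 <= y * y ^+ k.*2.+1.
    by rewrite ler_peMl ?ltW// exprn_gt0.
  have [x1|x1] := leP x 1.
    have : x * x ^+ k.*2.+1 <= x ^+ k.*2.+1 by rewrite ler_piMl.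
    lra.
  have X1 : 1 <= x ^+ k.*2.+1 by rewrite exprn_ege1 ?ltW.
  have : x * x ^+ k.*2.+1 <= y * y ^+ k.*2.+1.
    by rewrite ler_pM ?lerXn2r ?nnegrE ?(ltW x0) ?(ltW y0).
  lra.
have xy0 : 0 < (x * y)^-1 by rewrite invr_gt0 mulr_gt0.
have -> : x^-1 + y^-1 = (x * y)^-1 * (x + y) by field; rewrite !gt_eqF.
have -> : x^-1 - y^-1 = (x * y)^-1 * (y - x) by field; rewrite !gt_eqF.
rewrite -!mulrA -mulrBr normrM gtr0_norm// ler_pM2l//.
have yx0 : 0 <= y - x by rewrite subr_ge0.
have xym : x + y <= (x + y) * m by rewrite ler_peMr//; lra.
rewrite ler_norml; apply/andP; split; last first.
  have : 0 <= (y - x) * (gap x y k.+1 / 2 + gap x y k / 2).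
    by rewrite mulr_ge0// addr_ge0// divr_ge0.
  lra.
move: gb; rewrite /m gapS (exprS x k.*2.+1) (exprS y k.*2.+1).
lra.
Qed.

End Weights.

(** * The critical case *)

Section Critical.
Variables (R : realType) (d : nat).
Implicit Types (f : 'rV[R]_d -> R) (g : 'rV[R]_d -> 'rV[R]_d).

Lemma weighted_pair_ge0 (c u v w : R) :
  `|c| <= w -> `|u| <= v -> 0 <= w * v + c * u.
Proof.
move=> cw uv; have := ler_pM (normr_ge0 _) (normr_ge0 _) cw uv.
by rewrite -normrM => h; have := ler_norm (- (c * u)); rewrite normrN; lra.
Qed.

(** The hypotheses say that [f] has curvature between [1 - a] and [1 - b] for
    the critical pair [a = 1/x], [b = - 1/y].  By induction on [k],
      q_k (s tau_(k-1) + C_(k-1) - 2 a b <g_(k-1), g_k>)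
        + (2 q_k - a^(-2k) + b^(-2k)) |g_k|^2 <= 2 (a - b) (f(p_0) - f(p_k)),
    where [s = a + b], [tau_i] is the trapezoidal error between consecutive
    points and [C_i] its bound.  The left side is the part of the combination that
    involves the last two points only; everything before has cancelled. *)
Lemma critical_descent (x y : R) N f g (p : nat -> 'rV[R]_d) :
  0 < x -> 1 < y -> (0 < N)%N -> gap x y N = 0 ->
  quad_sandwich (1 - x^-1) (1 + y^-1) f g ->
  (forall i, (i < N)%N -> p i.+1 = p i - g (p i)) ->
  pow_sum N.*2 x * dot (g (p N)) (g (p N)) <= 2 * (f (p 0%N) - f (p N)).
Proof.
move=> x0 y1 N0 gN fg step; have y0 : 0 < y by lra.
have xy := gap_eq0_le x0 y1 N0 gN.
have g0 k : (k <= N)%N -> 0 <= gap x y k by exact: gap_ge0.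
pose a := x^-1; pose b := - y^-1; pose s := a + b; pose D := a - b.
have a0 : a != 0 by rewrite invr_eq0 gt_eqF.
have b0 : b != 0 by rewrite oppr_eq0 invr_eq0 gt_eqF.
have iy0 : 0 < y^-1 by rewrite invr_gt0.
have ix0 : 0 < x^-1 by rewrite invr_gt0.
have D0 : 0 < D by rewrite /D /a /b; lra.
have s0 : 0 <= s by rewrite /s /a /b subr_ge0 lef_pV2.
have sD : s <= D by rewrite /s /D /b; lra.
pose n i j := dot (g (p i)) (g (p j)).
pose tau i := 2 * (f (p i) - f (p i.+1)) - n i i - n i i.+1.
pose C i := s * n i i.+1 - n i.+1 i.+1 - a * b * n i i.
pose C2 i := - (a * b) * n i i - (1 - a) * (1 - b) * n i.+1 i.+1 - n i.+2 i.+2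
    + (s - 2 * (a * b)) * n i i.+1 + s * n i i.+2 + (s - 2) * n i.+1 i.+2.
pose A i := D * (n i i.+2 - n i.+1 i.+1).
have DE : 1 + y^-1 - (1 - x^-1) = D by rewrite /D /a /b; ring.
have mM : 1 - x^-1 < 1 + y^-1 by lra.
have tauC i : (i < N)%N -> `|D * tau i| <= C i.
  move=> iN; have := quad_sandwich_trapezoid (p i) (p i.+1) mM fg.
  have -> : p i - p i.+1 = g (p i) by rewrite step// subKr.
  rewrite DE normrM (gtr0_norm D0).
  congr (D * `| _ | <= _).
    by rewrite /tau /n !dotE (dotC (g (p i.+1))); ring.
  rewrite /C /n /s /a /b !dotE. rewrite (dotC (g (p i.+1)) (g (p i))); ring.
have tauC2 i : (i.+1 < N)%N -> `|D * (tau i + tau i.+1) - A i| <= C2 i.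
  move=> iN; have := quad_sandwich_trapezoid (p i) (p i.+2) mM fg.
  have -> : p i - p i.+2 = g (p i) + g (p i.+1).
    rewrite (step i.+1)// {1}(step i) ?(ltnW iN)//.
    by apply/matrixP => u v; rewrite !mxE; ring.
  rewrite DE /A -mulrBr normrM (gtr0_norm D0).
  congr (D * `| _ | <= _).
    rewrite /tau /n !dotE (dotC (g (p i.+2)) (g (p i))).
    by rewrite (dotC (g (p i.+2)) (g (p i.+1))); ring.
  rewrite /C2 /n /s /a /b !dotE (dotC (g (p i.+1)) (g (p i))).
  rewrite (dotC (g (p i.+2)) (g (p i))) (dotC (g (p i.+2)) (g (p i.+1))).
  by ring.
have xpow k : x ^+ k.+1 = x ^+ k / a by rewrite /a invrK exprSr.
have ypow k : y ^+ k.+1 = - (y ^+ k / b).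
  by rewrite /b invrN invrK mulrN opprK exprSr.
have rel k : 2 * (gap x y k / 2) * (1 - a) * (1 - b)
   = (1 - b) * (x ^+ k.*2 - 1) - (1 - a) * (y ^+ k.*2 - 1).
  by rewrite /b opprK -gap_closed// /a; field; rewrite !gt_eqF.
have gap2S k : gap x y k.+1 / 2 = gap x y k / 2
   + (x ^+ k.*2 / a - y ^+ k.*2 / b
      + (x ^+ k.*2 / a ^+ 2 - y ^+ k.*2 / b ^+ 2)) / 2.
  by rewrite gapS /a /b invrN !exprS; field; rewrite !gt_eqF.
(* The contribution of the pair (x_k, x_(k+1)). *)
have gain k : (k < N)%N -> 0 <= D * ((x ^+ k.*2 / a - y ^+ k.*2 / b
      - (x ^+ k.*2 / a ^+ 2 - y ^+ k.*2 / b ^+ 2)) / 2) * C k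
    + (D - s * (gap x y k.+1 / 2 + gap x y k / 2)) * (D * tau k).
  move=> kN; apply: weighted_pair_ge0 (tauC _ kN).
  have := weights_bound x0 y1 xy (g0 k (ltnW kN)) (g0 _ kN).
  congr (`| _ | <= _); first by rewrite /D /s /a /b; ring.
  rewrite /D /a /b !exprS; field; rewrite !gt_eqF//.
(* The potential after [k + 1] points, from the one after [k] points.  The
   quantities with an index before [k] are left arbitrary, so that the first
   step, where they have weight zero, is an instance. *)
have adv k n00 n01 n02 t0 : (k < N)%N ->
    gap x y k / 2 * (s * t0 + (s * n01 - n k k - a * b * n00)
        - 2 * (a * b) * n01)
      + (2 * (gap x y k / 2) - (x ^+ k.*2 - y ^+ k.*2)) * n k k
    <= D * (2 * (f (p 0%N) - f (p k))) ->
    0 <= gap x y k / 2 * (D * (- (a * b) * n00 - (1 - a) * (1 - b) * n k k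
        - n k.+1 k.+1 + (s - 2 * (a * b)) * n01 + s * n02 + (s - 2) * n k k.+1)
      + s * (D * (t0 + tau k) - D * (n02 - n k k))) ->
    gap x y k.+1 / 2 * (s * tau k + C k - 2 * (a * b) * n k k.+1)
      + (2 * (gap x y k.+1 / 2) - (x ^+ k.+1.*2 - y ^+ k.+1.*2)) * n k.+1 k.+1
    <= D * (2 * (f (p 0%N) - f (p k.+1))).
  move=> kN IH cross.
  have := multiplier_identity n00 n01 n02 (n k k) (n k k.+1) (n k.+1 k.+1)
    t0 (tau k) a0 b0 (rel k).
  rewrite /= -/s -/D -gap2S => idt.
  have := addr_ge0 (gain k kN) cross; rewrite /C -idt pmulr_rge0//.
  have -> : 2 * (gap x y k.+1 / 2) - (x ^+ k.+1.*2 - y ^+ k.+1.*2)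
     = 2 * (gap x y k / 2) + (x ^+ k.*2 / a - y ^+ k.*2 / b).
    by rewrite gap2S !doubleS !xpow !ypow; field; rewrite a0 b0.
  move: (gap x y k / 2) (gap x y k.+1 / 2) (_ / a - _) IH => q q' r IH.
  rewrite /tau; lra.
have inv j : (j < N)%N ->
    gap x y j.+1 / 2 * (s * tau j + C j - 2 * (a * b) * n j j.+1)
    + (2 * (gap x y j.+1 / 2) - (x ^+ j.+1.*2 - y ^+ j.+1.*2)) * n j.+1 j.+1
    <= D * (2 * (f (p 0%N) - f (p j.+1))).
  elim: j => [|j IH] jN.
    apply: (adv 0%N 0 0 0 0) => //; rewrite gap0 !mul0r//.
    by rewrite !subrr !mulr0 subr0 mul0r addr0.
  apply: (adv j.+1 (n j j) (n j j.+1) (n j j.+2) (tau j)) => //.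
    exact: IH (ltnW jN).
  rewrite mulr_ge0 ?divr_ge0 ?g0 1?ltnW//.
  rewrite -/(C2 j) -/(A j); apply: weighted_pair_ge0 (tauC2 j jN).
  by rewrite ger0_norm.
have := inv N.-1; rewrite prednK// => /(_ (leqnn _)).
rewrite gN !mul0r mulr0 add0r sub0r opprB => h.
rewrite -(ler_pM2l D0); apply: le_trans h; rewrite mulrA.
(* At [k = N] the weight [q_N] vanishes and the potential is the claim. *)
suff -> : D * pow_sum N.*2 x = y ^+ N.*2 - x ^+ N.*2 by [].
have ny0 : - y != 0 by rewrite oppr_eq0 gt_eqF.
have := pow_sumE N.*2 (lt0r_neq0 x0); have := pow_sumE N.*2 ny0.
move: gN; rewrite /gap evenexp_opp invrN opprK => /eqP.
rewrite subr_eq0 => /eqP <-.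
rewrite /D /a /b; lra.
Qed.
End Critical.

(** * Reduction to a critical pair of curvatures *)

Section IntermediateValue.
Variable R : realType.

Lemma pow_sum_horner n (z : R) :
  (\sum_(j < n) 'X^(j.+1) : {poly R}).[z] = pow_sum n z.
Proof. by rewrite horner_sum; apply: eq_bigr => j _; rewrite hornerXn. Qed.

Lemma pow_sum_ivt n (c lo hi : R) : lo <= hi ->
  pow_sum n lo <= c <= pow_sum n hi ->
  exists2 z, lo <= z <= hi & pow_sum n z = c.
Proof.
move=> lohi clh; pose P : {poly R} := \sum_(j < n) 'X^(j.+1) - c%:P.
have PE z : P.[z] = pow_sum n z - c.
  by rewrite hornerD hornerN hornerC pow_sum_horner.
have [|z zlh /rootP] := @poly_ivt R P lo hi lohi.
  by rewrite !PE subr_le0 subr_ge0.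
by rewrite PE => /eqP; rewrite subr_eq0 => /eqP zc; exists z.
Qed.

Lemma pow_sum_opp_ivt n (c lo hi : R) : lo <= hi ->
  pow_sum n (- lo) <= c <= pow_sum n (- hi) ->
  exists2 z, lo <= z <= hi & pow_sum n (- z) = c.
Proof.
move=> lohi /andP[cl ch].
pose P : {poly R} := c%:P - \sum_(j < n) 'X^(j.+1).
have PE z : P.[z] = c - pow_sum n z.
  by rewrite hornerD hornerN hornerC pow_sum_horner.
have [||z /andP[zl zh] /rootP] := @poly_ivt R P (- hi) (- lo).
- by rewrite lerN2.
- by rewrite !PE subr_le0 ch subr_ge0.
rewrite PE => /eqP; rewrite subr_eq0 => /eqP zc.
by exists (- z); rewrite ?opprK// lerNr lerNl zl zh.
Qed.

Lemma pow_sum_oppN1 k : pow_sum k.*2 (-1 : R) = 0.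
Proof.
elim: k => [|k IH]; first by rewrite pow_sum0.
by rewrite pow_sum_oppS IH !expr1n subrr addr0.
Qed.

End IntermediateValue.

Section Rates.
Variables (R : realType) (d : nat).
Implicit Types (f : 'rV[R]_d -> R) (g : 'rV[R]_d -> 'rV[R]_d).

(** Raising [M] to [1 + 1/y] makes the pair critical.  The power sum of [- y]
    runs from zero at [y = 1] to infinity, and by the hypothesis it has reached
    its target before [1 + 1/y] drops below [M]. *)
Lemma descent_low_curvature (m M : R) N f g (p : nat -> 'rV[R]_d) :
  m < 1 -> M < 2 -> (0 < N)%N ->
  (M <= 1) || (pow_sum N.*2 (1 - m)^-1 <= pow_sum N.*2 (1 - M)^-1) ->
  quad_sandwich m M f g -> (forall i, (i < N)%N -> p i.+1 = p i - g (p i)) ->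
  pow_sum N.*2 (1 - m)^-1 * dot (g (p N)) (g (p N))
  <= 2 * (f (p 0%N) - f (p N)).
Proof.
move=> m1 M2 N0 le fg step; set x := (1 - m)^-1.
have x0 : 0 < x by rewrite invr_gt0 subr_gt0.
have c0 : 0 < pow_sum N.*2 x.
  case: N N0 {le step} => // N _.
  by rewrite doubleS (lt_le_trans x0)// pow_sum_ge// ltW.
have [y1 [ge1 yM cy]] : exists y1, [/\ 1 <= y1,
    forall y, 1 < y -> y <= y1 -> M <= 1 + y^-1
    & pow_sum N.*2 x <= pow_sum N.*2 (- y1)].
  have [M1|M1] := leP M 1.
    exists (1 + pow_sum N.*2 x); split; first by rewrite lerDl ltW.
      move=> y y1 _; apply: le_trans M1 _; rewrite lerDl invr_ge0; lra.
    have := @pow_sum_opp_ge R N.-1 (1 + pow_sum N.*2 x); rewrite prednK//.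
    by rewrite addrAC subrr add0r; apply; rewrite lerDl ltW.
  exists (M - 1)^-1; split.
  - by rewrite invf_ge1 ?subr_gt0//; lra.
  - move=> y y1 yM; have y0 : 0 < y by lra.
    by rewrite -lerBlDl -[M - 1]invrK lef_pV2// posrE invr_gt0 subr_gt0.
  - by move: le; rewrite leNgt M1/= -invrN opprB.
have [|y /andP[yl yh] yx] := @pow_sum_opp_ivt R N.*2 (pow_sum N.*2 x) 1 y1 ge1.
  by rewrite pow_sum_oppN1 (ltW c0).
have y1' : 1 < y.
  rewrite lt_neqAle yl andbT; apply/eqP => y1E.
  by move: c0; rewrite -yx -y1E pow_sum_oppN1 ltxx.
apply: (critical_descent x0 y1' N0 _ _ step); first by rewrite /gap yx subrr.
by apply: quad_sandwich_widen fg; [rewrite /x invrK; lra | exact: yM].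
Qed.

(** Lowering [m] to [1 - 1/x] makes the pair critical; the new bound can be
    negative.  When [1 <= m], every [x] is admissible. *)
Lemma descent_high_curvature (m M : R) N f g (p : nat -> 'rV[R]_d) :
  1 < M -> M < 2 -> (0 < N)%N ->
  (1 <= m) || (pow_sum N.*2 (1 - M)^-1 <= pow_sum N.*2 (1 - m)^-1) ->
  quad_sandwich m M f g -> (forall i, (i < N)%N -> p i.+1 = p i - g (p i)) ->
  pow_sum N.*2 (1 - M)^-1 * dot (g (p N)) (g (p N))
  <= 2 * (f (p 0%N) - f (p N)).
Proof.
move=> M1 M2 N0 le fg step; pose y := (M - 1)^-1.
have yE : (1 - M)^-1 = - y by rewrite /y -invrN opprB.
have y1 : 1 < y by rewrite invf_gt1 ?subr_gt0//; lra.
rewrite yE in le *; set c := pow_sum _ _ in le *.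
have c0 : 0 < c.
  have := @pow_sum_opp_ge R N.-1 y (ltW y1); rewrite prednK// -/c; lra.
have [x1 [x10 xm cx]] : exists x1, [/\ 0 <= x1,
    forall x, 0 < x -> x <= x1 -> 1 - x^-1 <= m & c <= pow_sum N.*2 x1].
  have [m1|m1] := leP 1 m.
    exists c; split; first exact: ltW.
      by move=> x x0 _; apply: le_trans m1; rewrite gerDl oppr_le0 invr_ge0 ltW.
    case: N N0 @c c0 {le step} => // N _ c c0.
    by rewrite doubleS pow_sum_ge// ltW.
  exists (1 - m)^-1; split.
  - by rewrite invr_ge0; lra.
  - move=> x x0 xm; rewrite lerBlDr -lerBlDl.
    by rewrite -[1 - m]invrK lef_pV2// posrE invr_gt0 subr_gt0.
  - by move: le; rewrite leNgt m1.
have [|x /andP[xl xh] xc] := @pow_sum_ivt R N.*2 c 0 x1 x10.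
  rewrite cx andbT (_ : pow_sum _ _ = 0) ?ltW//.
  by rewrite /pow_sum big1// => j _; rewrite expr0n.
have x0 : 0 < x.
  rewrite lt_neqAle xl andbT; apply/eqP => x0E; move: c0; rewrite -xc -x0E.
  by rewrite /pow_sum big1 ?ltxx// => j _; rewrite expr0n.
rewrite -xc; apply: (critical_descent x0 y1 N0 _ _ step).
  by rewrite /gap xc subrr.
by apply: quad_sandwich_widen fg; [exact: xm | rewrite /y invrK; lra].
Qed.

End Rates.

(** * The extended-real bound *)

Section RateTerm.
Variable R : realType.
Implicit Types (gamma m : R).

Lemma rate_term_pow_sum gamma m N : gamma * m != 0 -> gamma * m != 1 ->
  rate_term gamma m N = (pow_sum N.*2 (1 - gamma * m)^-1)%:E.
Proof.
move=> m0 m1; have z0 : 1 - gamma * m != 0 by rewrite subr_eq0 eq_sym.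
have := @pow_sumE R N.*2 (1 - gamma * m)^-1; rewrite invr_neq0// => /(_ isT).
rewrite invrK subKr exprVn => E.
rewrite /rate_term mul2n -EFin_expe inver (negPf (expf_neq0 _ z0)).
rewrite inver (negPf m0).
rewrite -EFinN -EFinD -EFinM; congr EFin.
by rewrite addrC -E mulrC mulKf.
Qed.

Lemma rate_term_ge0 gamma m N : 0 < gamma * m < 2 -> (0 < N)%N ->
  (0 <= rate_term gamma m N)%E.
Proof.
move=> /andP[m0 m2] N0.
have [m1|m1] := eqVneq (gamma * m) 1; last first.
  rewrite (rate_term_pow_sum N (lt0r_neq0 m0) m1) lee_fin.
  have [m1'|m1'] := ltP (gamma * m) 1.
    by rewrite pow_sum_ge0// invr_ge0 subr_ge0 ltW.
  have -> : (1 - gamma * m)^-1 = - (gamma * m - 1)^-1 by rewrite -invrN opprB.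
  by rewrite pow_sum_opp_ge0// invf_ge1; lra.
rewrite /rate_term m1 subrr -EFin_expe expr0n muln_eq0 (gtn_eqF N0)/=.
by rewrite !inver eqxx oner_eq0 invr1 mule1 addey// leey.
Qed.

End RateTerm.

(** The upper quadratic bound is minimal after a gradient step of length
    [1/M]. *)
Lemma sandwich_inf_bound (R : realType) d (m M : R) (f : 'rV[R]_d -> R) g x :
  0 < M -> quad_sandwich m M f g ->
  (ereal_inf (range (fun y => (f y)%:E)) <=
    (f x - (2 * M)^-1 * dot (g x) (g x))%:E)%E.
Proof.
move=> M0 fg; have [_ h] := fg x (- (M^-1 *: g x)).
apply: le_trans (_ : (f (x - M^-1 *: g x))%:E <= _)%E.
  by apply: ereal_inf_lbound; exists (x - M^-1 *: g x).
rewrite lee_fin; apply: le_trans h _; rewrite !dotE.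
rewrite le_eqVlt; apply/orP; left; apply/eqP; field; lra.
Qed.

Unset Implicit Arguments.

Theorem theorem2p3 (R : realType) (d : nat) (L mu gamma : R)
    (f : 'rV[R]_d -> R) (N : nat) (x : nat -> 'rV[R]_d)
    (L_gt0 : 0 < L) (mu_gt0 : 0 < mu) (mu_ltL : mu < L)
    (f_class : curvature_class mu L f)
    (N_ge1 : (1 <= N)%N)
    (gammaL_gt0 : 0 < gamma * L) (gammaL_lt2 : gamma * L < 2)
    (x_step : forall i, (i < N)%N -> x i.+1 = x i - gamma *: gradient f (x i)) :
  (((2 * L)^-1 * enorm (gradient f (x N)) ^+ 2)%:E <=
    ((f (x 0%N))%:E - ereal_inf (range (fun y => (f y)%:E))) /
      (1 + (gamma * L)%:E * mine (rate_term gamma mu N) (rate_term gamma L N)))%E.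
Proof.
have fg := curvature_class_sandwich (ltW mu_ltL) f_class.
have gamma_gt0 : 0 < gamma by rewrite -(pmulr_lgt0 _ L_gt0).
have gg := quad_sandwich_scale (ltW gamma_gt0) fg.
have gmu_gt0 : 0 < gamma * mu by rewrite mulr_gt0.
have gmuL : gamma * mu < gamma * L by rewrite ltr_pM2l.
pose S m := pow_sum N.*2 (1 - gamma * m)^-1.
pose G := gamma *: gradient f (x N).
(* The conclusion is monotone in the rate, so an upper bound of the minimum
   that satisfies the descent inequality is enough.  In particular neither term
   has to be evaluated when it is infinite. *)
have [E minE descent] : exists2 E : R,
    (mine (rate_term gamma mu N) (rate_term gamma L N) <= E%:E)%E &
    E * dot G G <= 2 * (gamma * f (x 0%N) - gamma * f (x N)).
  have low : gamma * mu < 1 -> (gamma * L <= 1) || (S mu <= S L) ->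
      (mine (rate_term gamma mu N) (rate_term gamma L N) <= (S mu)%:E)%E /\
      S mu * dot G G <= 2 * (gamma * f (x 0%N) - gamma * f (x N)).
    move=> mu1 le; split.
      by rewrite ge_min rate_term_pow_sum ?lexx ?(gt_eqF gmu_gt0) ?(lt_eqF mu1).
    exact: (descent_low_curvature mu1 gammaL_lt2 N_ge1 le gg).
  have high : 1 < gamma * L -> (1 <= gamma * mu) || (S L <= S mu) ->
      (mine (rate_term gamma mu N) (rate_term gamma L N) <= (S L)%:E)%E /\
      S L * dot G G <= 2 * (gamma * f (x 0%N) - gamma * f (x N)).
    move=> L1 le; split.
      by rewrite ge_min (@rate_term_pow_sum _ _ L) ?lexx ?orbT ?gt_eqF.
    exact: (descent_high_curvature L1 gammaL_lt2 N_ge1 le gg).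
  have [mu1|mu1] := ltP (gamma * mu) 1; last first.
    have [||le h] := high; first exact: le_lt_trans gmuL.
      by rewrite mu1.
    by exists (S L).
  have [L1|L1] := leP (gamma * L) 1.
    by have [||le h] := low; [exact: mu1 | rewrite L1 | exists (S mu)].
  have [SS|SS] := leP (S mu) (S L).
    by have [||le h] := low; [exact: mu1 | rewrite SS orbT | exists (S mu)].
  by have [||le h] := high; [exact: L1 | rewrite (ltW SS) orbT | exists (S L)].
have min0 : (0 <= mine (rate_term gamma mu N) (rate_term gamma L N))%E.
  rewrite le_min !rate_term_ge0 ?gmu_gt0 ?gammaL_gt0//.
  by rewrite (lt_trans gmuL).
have [r rE] : exists r,
    mine (rate_term gamma mu N) (rate_term gamma L N) = r%:E.
  by move: min0 minE; case: mine => // r _ _; exists r.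
rewrite rE in minE min0 *; rewrite !lee_fin in minE min0.
have fstar := sandwich_inf_bound (x N) L_gt0 fg.
rewrite enorm_sqr; set q := dot _ _ in fstar *.
set A := (2 * L)^-1 * q in fstar *; have q0 : 0 <= q by exact: dot_ge0.
have den : 0 < 1 + gamma * L * r by rewrite ltr_pwDl// mulr_ge0// ltW.
rewrite -EFinM -EFinD inver gt_eqF//.
have -> : A%:E = ((A * (1 + gamma * L * r))%:E * ((1 + gamma * L * r)^-1)%:E)%E.
  by rewrite -EFinM mulfK// gt_eqF.
apply: lee_wpmul2r; first by rewrite lee_fin invr_ge0 ltW.
apply: le_trans (leeB (lexx _) fstar).
rewrite -EFinB lee_fin.
have drop : gamma * (r * q) <= 2 * (f (x 0%N) - f (x N)).
  rewrite -(ler_pM2l gamma_gt0).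
  apply: le_trans (_ : gamma * (gamma * (E * q)) <= _).
    by rewrite !ler_pM2l// ler_wpM2r.
  by move: descent; rewrite /G dotZl dotZr -/q; lra.
have -> : A * (1 + gamma * L * r) = A + gamma * (r * q) / 2.
  by rewrite /A; field; rewrite gt_eqF.
lra.
Qed.
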